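(* Let $n\ge 1$ and let $\mathcal X=\{X^u\}_{u\in\mathbb Z^n}$ be an $n$-parameter filtration of a cell complex $X$. For each $q\ge0$ and each fixed grade $u\in\mathbb Z^n$, $$\mu_q(u)\ \ge\ \xi_0^q(u)-\sum_{p=1}^{q+1}\xi_p^{q+1-p}(u),$$ where $\mu_q(u)=\dim H_q(X^u,\bigcup_{j=1}^nX^{u-e_j})$ is the homological Morse number and $\xi^q_p(u)$ are the Betti tables of the persistence modules $V_q=H_q(\mathcal X)$.
   Context: Fix a field $\mathbb F$; all homology is over $\mathbb F$ and $\dim$ means $\dim_{\mathbb F}$. Cell complexes. A cell complex is a finite graded set $X=\bigsqcup_{q\ge 0}X_q$ (elements of $X_q$ are called $q$-cells) with an incidence function $\kappa:X\times X\to\mathbb F$ such that $\kappa(\tau,\sigma)\ne0$ implies $\dim\tau=\dim\sigma+1$, and $\sum_{\rho}\kappa(\tau,\rho)\kappa(\rho,\sigma)=0$ for all $\tau,\sigma$. Its chain complex $C_*(X)$ has $C_q(X)$ with basis $X_q$ and $\partial_q(\tau)=\sum_{\sigma\in X_{q-1}}\kappa(\tau,\sigma)\sigma$. The partial order $\le$ on $X$ is generated by $\sigma<\tau$ whenever $\kappa(\tau,\sigma)\neq0$. A subcomplex $A\subseteq X$ is a subset generating a chain subcomplex $C_*(A)\subseteq C_*(X)$. $H_q(X)$ is the homology of $C_*(X)$, and $H_q(X,A)$ that of $C_*(X)/C_*(A)$. Filtrations. For $n\ge1$, $[n]=\{1,\dots,n\}$, $e_1,\dots,e_n$ is the standard basis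 of $\mathbb Z^n$, $e_\sigma=\sum_{j\in\sigma}e_j$ for $\sigma\subseteq[n]$, and $\preceq$ is the coordinatewise order on $\mathbb Z^n$. An $n$-parameter filtration of $X$ is a family $\{X^u\}_{u\in\mathbb Z^n}$ of subcomplexes with $X^u\subseteq X^v$ for $u\preceq v$. All filtrations are assumed one-critical, i.e. $X^u=\{\sigma\in X\mid f(\sigma)\preceq u\}$ for some order-preserving $f:(X,\le)\to(\mathbb Z^n,\preceq)$, and bounded, i.e. $X^u\neq\emptyset$ implies $0\preceq u$, and $X^u=X$ for $u$ sufficiently large. Homological Morse numbers: $\mu_q(u):=\dim H_q(X^u,\bigcup_{j=1}^nX^{u-e_j})$. Koszul complex and Betti tables. $V_q=H_q(\mathcal X)$ is the persistence module with $V_q^u=H_q(X^u)$ and maps $\iota_q^{u,v}:H_q(X^u)\to H_q(X^v)$ induced by inclusions. Its Koszul complex at grade $u$ has $\mathbb K_i(x_1,\dots,x_n;V_q)(u)=\bigoplus_{\sigma\subseteq[n],|\sigma|=i}H_q(X^{u-e_\sigma})$ for $0\le i\le n$ and $0$ otherwise; its differential $d_i$ restricted to the summand of $\sigma=\{j_1<\dots<j_i\}$ is $\sum_{r=0}^{i-1}(-1)^r\iota_q^{u-e_\sigma,\,u-e_{\sigma\setminus\{j_{i-r}\}}}$. The Betti table is $\xi_i^q(u):=\dim H_i(\mathbb K_*(x_1,\dots,x_n;V_q)(u))$ (so $\xi^q_i(u)=0$ unless $0\le i\le n$ and $q\ge0$). *)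

(* Defs.v *)
From HB Require Import structures.
From mathcomp Require Import all_boot all_order all_algebra.

Set Implicit Arguments.
Unset Strict Implicit.
Unset Printing Implicit Defensive.

Import Order.TTheory GRing.Theory Num.Theory.

Local Open Scope ring_scope.
Local Open Scope quotient_scope.

(** * Quotients and finite direct sums of vector spaces *)

Section QuotientSpace.

Variables (F : fieldType) (vT : vectType F) (U : {vspace vT}).

Definition quotv : Type := Quotient.quot (pred_of_vspace U).

HB.instance Definition _ := Choice.on quotv.
HB.instance Definition _ := GRing.Zmodule.on quotv.

Definition quotv_pi_fun (v : vT) : quotv :=
  \pi_(Quotient.quot (pred_of_vspace U)) v.
Definition quotv_repr (x : quotv) : vT :=
  repr (x : Quotient.quot (pred_of_vspace U)).

Fact quotv_reprK : cancel quotv_repr quotv_pi_fun.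
Proof. exact: reprK. Qed.

Fact quotv_pi_funD : {morph quotv_pi_fun : v w / v + w}.
Proof. exact: raddfD. Qed.

Fact quotv_pi_fun_eq v w : (quotv_pi_fun v == quotv_pi_fun w) = (v - w \in U).
Proof. by rewrite /quotv_pi_fun (Quotient.idealrBE (pred_of_vspace U)). Qed.

Definition quotv_scale (a : F) (x : quotv) : quotv :=
  quotv_pi_fun (a *: quotv_repr x).

Fact quotv_pi_funZ a v : quotv_pi_fun (a *: v) = quotv_scale a (quotv_pi_fun v).
Proof.
apply/eqP; rewrite quotv_pi_fun_eq -scalerBr memvZ // -quotv_pi_fun_eq.
by rewrite quotv_reprK.
Qed.

Fact quotv_scaleA a b x :
  quotv_scale a (quotv_scale b x) = quotv_scale (a * b) x.
Proof. by rewrite -[x]quotv_reprK -!quotv_pi_funZ scalerA. Qed.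

Fact quotv_scale1 : left_id 1 quotv_scale.
Proof. by move=> x; rewrite -[x]quotv_reprK -!quotv_pi_funZ scale1r. Qed.

Fact quotv_scaleDr : right_distributive quotv_scale +%R.
Proof.
move=> a x y; rewrite -[x]quotv_reprK -[y]quotv_reprK.
by rewrite -quotv_pi_funD -!quotv_pi_funZ scalerDr quotv_pi_funD.
Qed.

Fact quotv_scaleDl x : {morph quotv_scale^~ x : a b / a + b}.
Proof.
move=> a b; rewrite -[x]quotv_reprK -!quotv_pi_funZ scalerDl.
by rewrite quotv_pi_funD.
Qed.

HB.instance Definition _ := GRing.Zmodule_isLmodule.Build F quotv
  quotv_scaleA quotv_scale1 quotv_scaleDr quotv_scaleDl.

Fact quotv_pi_linear : linear quotv_pi_fun.
Proof. by move=> a v w; rewrite quotv_pi_funD quotv_pi_funZ. Qed.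
HB.instance Definition _ := GRing.isLinear.Build F vT quotv _ quotv_pi_fun
  quotv_pi_linear.

Let p : 'End(vT) := (\1 - projv U)%VF.

Let pE v : p v = v - projv U v.
Proof. by rewrite /p add_lfunE opp_lfunE id_lfunE. Qed.

Let p_ker v : (p v == 0) = (v \in U).
Proof.
rewrite pE subr_eq0; apply/eqP/idP => [->|vU].
  exact: memv_proj.
by rewrite projv_id.
Qed.

Let p_pi v : quotv_pi_fun (p v) = quotv_pi_fun v.
Proof.
apply/eqP; rewrite quotv_pi_fun_eq pE.
by rewrite addrAC subrr add0r memvN memv_proj.
Qed.

Import VectorInternalTheory.
Fact quotv_vect_iso : Vector.axiom (\dim (limg p)) quotv.
Proof.
pose h (s : subvs_of (limg p)) : quotv := quotv_pi_fun (vsval s).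
pose g (x : quotv) : subvs_of (limg p) := vsproj (limg p) (p (quotv_repr x)).
have gE v : g (quotv_pi_fun v) = vsproj (limg p) (p v).
  rewrite /g; congr vsproj; apply/eqP; rewrite -subr_eq0 -linearB p_ker.
  by rewrite -quotv_pi_fun_eq quotv_reprK.
have hK : cancel g h.
  move=> x; rewrite /g /h vsprojK ?memv_img ?memvf // p_pi.
  exact: quotv_reprK.
have gK : cancel h g.
  move=> s; rewrite /h gE; have /memv_imgP[v _ sE] := subvsP s.
  rewrite -[RHS]vsvalK sE; congr vsproj; apply/eqP.
  by rewrite -subr_eq0 -linearB p_ker -quotv_pi_fun_eq p_pi.
exists (fun x => v2r (g x)).
  move=> a x y; rewrite -[x]quotv_reprK -[y]quotv_reprK -quotv_pi_linear.
  by rewrite !gE !linearP.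
exists (fun r => h (r2v r)) => [x | r]; first by rewrite v2rK hK.
by rewrite gK r2vK.
Qed.

HB.instance Definition _ := Lmodule_hasFinDim.Build F quotv quotv_vect_iso.

Definition quotv_pi : 'Hom(vT, quotv) := linfun quotv_pi_fun.

Lemma quotv_pi_ker : lker quotv_pi = U.
Proof.
apply/vspaceP => v; rewrite memv_ker lfunE -(subr0 v) -quotv_pi_fun_eq subr0.
by rewrite -(linear0 quotv_pi_fun).
Qed.

Lemma quotv_pi_surj : limg quotv_pi = fullv.
Proof.
apply/vspaceP => x; rewrite memvf -[x]quotv_reprK -[quotv_pi_fun _]lfunE.
by rewrite memv_img ?memvf.
Qed.

End QuotientSpace.

Section QuotientMap.
Variables (F : fieldType) (vT wT : vectType F).

(* [(quotv_pi U)^-1] is a linear section of the projection; the map below does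
   not depend on it when [h] sends [U] into [W]. *)
Definition quotv_map (h : 'Hom(vT, wT)) (U : {vspace vT}) (W : {vspace wT}) :
  'Hom(quotv U, quotv W) := (quotv_pi W \o h \o (quotv_pi U)^-1)%VF.

Lemma quotv_mapE h U W v : (h @: U <= W)%VS ->
  quotv_map h U W (quotv_pi U v) = quotv_pi W (h v).
Proof.
move=> hUW; rewrite /quotv_map !comp_lfunE.
apply/eqP; rewrite -subr_eq0 -!linearB -memv_ker quotv_pi_ker.
apply: (subvP hUW); rewrite memv_img //.
suff: (quotv_pi U)^-1%VF (quotv_pi U v) - v \in lker (quotv_pi U).
  by rewrite quotv_pi_ker.
by rewrite memv_ker linearB /= limg_lfunVK ?subrr // quotv_pi_surj memvf.
Qed.

Lemma linfun_vsvalE (U : {vspace vT}) (x : subvs_of U) :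
  (linfun vsval : 'Hom(subvs_of U, vT)) x = vsval x.
Proof. exact: lfunE. Qed.

Definition subvs_map (h : 'Hom(vT, wT)) (U : {vspace vT}) (W : {vspace wT}) :
  'Hom(subvs_of U, subvs_of W) := (linfun (vsproj W) \o h \o linfun vsval)%VF.

Lemma subvs_mapE h U W x : (h @: U <= W)%VS ->
  vsval (subvs_map h U W x) = h (vsval x).
Proof.
move=> hUW; rewrite /subvs_map !comp_lfunE !lfunE /= vsprojK //.
by apply: (subvP hUW); rewrite memv_img ?subvsP.
Qed.

End QuotientMap.

Section DirectSum.

Variables (F : fieldType) (I : finType) (V : I -> vectType F).

Definition dsum : Type := {dffun forall i, V i}.
HB.instance Definition _ := Choice.on dsum.

Definition dsum_mk (g : forall i, V i) : dsum := [ffun i => g i].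
Definition dsum_val (f : dsum) i : V i := (f : {dffun forall i, V i}) i.

Lemma dsum_mkE g i : dsum_val (dsum_mk g) i = g i.
Proof. by rewrite /dsum_val ffunE. Qed.
Lemma dsumP (f g : dsum) : (forall i, dsum_val f i = dsum_val g i) -> f = g.
Proof. by move=> fg; apply/ffunP. Qed.

Definition dsum_add (f g : dsum) := dsum_mk (fun i => dsum_val f i + dsum_val g i).
Definition dsum_opp (f : dsum) := dsum_mk (fun i => - dsum_val f i).
Definition dsum_scale (a : F) (f : dsum) := dsum_mk (fun i => a *: dsum_val f i).

Fact dsum_addA : associative dsum_add.
Proof. by move=> f g h; apply: dsumP => i; rewrite !dsum_mkE addrA. Qed.
Fact dsum_addC : commutative dsum_add.
Proof. by move=> f g; apply: dsumP => i; rewrite !dsum_mkE addrC. Qed.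
Fact dsum_add0 : left_id (dsum_mk (fun=> 0)) dsum_add.
Proof. by move=> f; apply: dsumP => i; rewrite !dsum_mkE add0r. Qed.
Fact dsum_addN : left_inverse (dsum_mk (fun=> 0)) dsum_opp dsum_add.
Proof. by move=> f; apply: dsumP => i; rewrite !dsum_mkE addNr. Qed.
HB.instance Definition _ := GRing.isZmodule.Build dsum
  dsum_addA dsum_addC dsum_add0 dsum_addN.

Fact dsum_scaleA a b f : dsum_scale a (dsum_scale b f) = dsum_scale (a * b) f.
Proof. by apply: dsumP => i; rewrite !dsum_mkE scalerA. Qed.
Fact dsum_scale1 : left_id 1 dsum_scale.
Proof. by move=> f; apply: dsumP => i; rewrite !dsum_mkE scale1r. Qed.
Fact dsum_scaleDr : right_distributive dsum_scale +%R.
Proof. by move=> a f g; apply: dsumP => i; rewrite !dsum_mkE scalerDr. Qed.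
Fact dsum_scaleDl f : {morph dsum_scale^~ f : a b / a + b}.
Proof. by move=> a b; apply: dsumP => i; rewrite !dsum_mkE scalerDl. Qed.
HB.instance Definition _ := GRing.Zmodule_isLmodule.Build F dsum
  dsum_scaleA dsum_scale1 dsum_scaleDr dsum_scaleDl.

Lemma dsumDE (f g : dsum) i : dsum_val (f + g) i = dsum_val f i + dsum_val g i.
Proof. exact: dsum_mkE. Qed.
Lemma dsumZE a (f : dsum) i : dsum_val (a *: f) i = a *: dsum_val f i.
Proof. exact: dsum_mkE. Qed.
Lemma dsum0E i : dsum_val (0 : dsum) i = 0.
Proof. exact: dsum_mkE. Qed.

Let J := {i : I & 'I_(dim (V i))}.
Import VectorInternalTheory.
Fact dsum_vect_iso : Vector.axiom #|{: J}| dsum.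
Proof.
pose to (f : dsum) : 'rV[F]_#|{: J}| :=
  \row_k v2r (dsum_val f (tag (enum_val k))) 0 (tagged (enum_val k)).
pose fro (r : 'rV[F]_#|{: J}|) : dsum :=
  dsum_mk (fun i => r2v (\row_k r 0 (enum_rank (Tagged (fun i => 'I_(dim (V i))) k)))).
exists to.
  by move=> a f g; apply/rowP => k; rewrite !mxE dsumDE dsumZE linearP !mxE.
exists fro => [f | r].
  apply: dsumP => i; rewrite dsum_mkE; apply: (canLR v2rK).
  by apply/rowP => k; rewrite !mxE enum_rankK.
apply/rowP => k; rewrite !mxE dsum_mkE r2vK mxE.
by rewrite -[in RHS](enum_valK k); case: (enum_val k).
Qed.
HB.instance Definition _ := Lmodule_hasFinDim.Build F dsum dsum_vect_iso.

End DirectSum.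

(** * Chain complexes *)

Record chain_complex (F : fieldType) := ChainComplex {
  chain_sp :> nat -> vectType F;
  diff : forall q, 'Hom(chain_sp q.+1, chain_sp q);
  diff_comp : forall q, (diff q \o diff q.+1)%VF = 0
}.

Section Homology.

Variable F : fieldType.
Implicit Types K L M : chain_complex F.

Definition cycles K q : {vspace K q} :=
  match q with 0 => fullv | q'.+1 => lker (diff K q') end.

Definition boundaries K q : {vspace subvs_of (cycles K q)} :=
  (linfun vsval @^-1: limg (diff K q))%VS.

Definition homology K q : vectType F := quotv (boundaries K q).

Lemma diff_diff K q x : diff K q (diff K q.+1 x) = 0.
Proof. by rewrite -comp_lfunE diff_comp zero_lfunE. Qed.

Definition chain_map K L (f : forall q, 'Hom(K q, L q)) :=
  forall q x, diff L q (f q.+1 x) = f q (diff K q x).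

Definition homology_map K L (f : forall q, 'Hom(K q, L q)) q :
    'Hom(homology K q, homology L q) :=
  quotv_map (subvs_map (f q) (cycles K q) (cycles L q))
            (boundaries K q) (boundaries L q).

Lemma chain_map_cycles K L (f : forall q, 'Hom(K q, L q)) : chain_map f ->
  forall q, (f q @: cycles K q <= cycles L q)%VS.
Proof.
move=> fC [|q] /=; first exact: subvf.
apply/subvP => _ /memv_imgP[z zK ->]; rewrite memv_ker fC.
by move: zK; rewrite memv_ker => /eqP ->; rewrite linear0.
Qed.

Lemma homology_mapE K L (f : forall q, 'Hom(K q, L q)) q z : chain_map f ->
  homology_map f q (quotv_pi (boundaries K q) z) =
  quotv_pi (boundaries L q) (subvs_map (f q) (cycles K q) (cycles L q) z).
Proof.
move=> fC; have fZ := chain_map_cycles fC q.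
rewrite /homology_map quotv_mapE //; apply/subvP => _ /memv_imgP[w wB ->].
move: wB; rewrite -!memv_preim !linfun_vsvalE subvs_mapE // => /memv_imgP[x _ ->].
by rewrite -fC memv_img ?memvf.
Qed.

Lemma homology_map_id K (f : forall q, 'Hom(K q, K q)) q :
  (forall p, f p = \1%VF) -> homology_map f q = \1%VF.
Proof.
move=> f1.
have fC : chain_map f by move=> p x; rewrite !f1 !id_lfunE.
apply/lfunP => x; have : x \in limg (quotv_pi (boundaries K q)).
  by rewrite quotv_pi_surj memvf.
case/memv_imgP => z _ ->; rewrite homology_mapE // id_lfunE.
congr (quotv_pi _ _); apply: val_inj.
by rewrite /= subvs_mapE ?f1 ?id_lfunE // -(f1 q) chain_map_cycles.
Qed.

Lemma homology_map_comp K L M (f : forall q, 'Hom(K q, L q))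
    (g : forall q, 'Hom(L q, M q)) (h : forall q, 'Hom(K q, M q)) q :
    chain_map f -> chain_map g -> (forall p, h p = g p \o f p)%VF ->
  homology_map h q = (homology_map g q \o homology_map f q)%VF.
Proof.
move=> fC gC hE.
have hC : chain_map h by move=> p x; rewrite !hE !comp_lfunE gC fC.
apply/lfunP => x; have : x \in limg (quotv_pi (boundaries K q)).
  by rewrite quotv_pi_surj memvf.
case/memv_imgP => z _ ->; rewrite comp_lfunE !homology_mapE //.
congr (quotv_pi _ _); apply: val_inj.
by rewrite /= !subvs_mapE ?hE ?comp_lfunE -?hE // chain_map_cycles.
Qed.

Record chain_subcomplex K := ChainSubcomplex {
  sub_sp :> forall q, {vspace K q};
  sub_spP : forall q, (diff K q @: sub_sp q.+1 <= sub_sp q)%VS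
}.

Fact sub_diff_comp K (S : chain_subcomplex K) q :
  (subvs_map (diff K q) (S q.+1) (S q) \o
   subvs_map (diff K q.+1) (S q.+2) (S q.+1))%VF = 0.
Proof.
apply/lfunP => x; apply: val_inj.
by rewrite /= comp_lfunE !subvs_mapE ?sub_spP // diff_diff zero_lfunE.
Qed.
Definition sub_complex K (S : chain_subcomplex K) : chain_complex F :=
  @ChainComplex F (fun q => subvs_of (S q))
    (fun q => subvs_map (diff K q) (S q.+1) (S q)) (sub_diff_comp S).

Fact quot_diff_comp K (S : chain_subcomplex K) q :
  (quotv_map (diff K q) (S q.+1) (S q) \o
   quotv_map (diff K q.+1) (S q.+2) (S q.+1))%VF = 0.
Proof.
apply/lfunP => x; have : x \in limg (quotv_pi (S q.+2)).
  by rewrite quotv_pi_surj memvf.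
case/memv_imgP => y _ ->.
by rewrite comp_lfunE !quotv_mapE ?sub_spP // diff_diff linear0 zero_lfunE.
Qed.
Definition quot_complex K (S : chain_subcomplex K) : chain_complex F :=
  @ChainComplex F (fun q => quotv (S q))
    (fun q => quotv_map (diff K q) (S q.+1) (S q)) (quot_diff_comp S).

(* [T] as a subcomplex of [S]; in general, the intersection of [S] and [T]. *)
Fact sub_in_subproof K (S T : chain_subcomplex K) q :
  (diff (sub_complex S) q @: (linfun vsval @^-1: T q.+1) <=
   linfun vsval @^-1: T q)%VS.
Proof.
apply/subvP => _ /memv_imgP[x xT ->]; move: xT.
rewrite -!memv_preim !linfun_vsvalE subvs_mapE ?sub_spP // => xT.
by apply: (subvP (sub_spP T q)); rewrite memv_img.
Qed.
Definition sub_in K (S T : chain_subcomplex K) :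
    chain_subcomplex (sub_complex S) :=
  @ChainSubcomplex (sub_complex S) (fun q => linfun vsval @^-1: T q)%VS
    (sub_in_subproof S T).

(* Meaningful only when [S] is contained in [T]: it is then the inclusion. *)
Definition sub_incl K (S T : chain_subcomplex K) q :
    'Hom(sub_complex S q, sub_complex T q) := subvs_map \1 (S q) (T q).

Lemma sub_inclE K (S T : chain_subcomplex K) q x : (S q <= T q)%VS ->
  vsval (sub_incl S T q x) = vsval x.
Proof. by move=> ST; rewrite /sub_incl subvs_mapE ?id_lfunE // lim1g. Qed.

Lemma sub_incl_chain_map K (S T : chain_subcomplex K) :
  (forall q, (S q <= T q)%VS) -> chain_map (sub_incl S T).
Proof.
move=> ST q x; apply: val_inj.
by rewrite /= subvs_mapE ?sub_spP // !sub_inclE // subvs_mapE ?sub_spP.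
Qed.

Lemma sub_incl_id K (S : chain_subcomplex K) q : sub_incl S S q = \1%VF.
Proof. by apply/lfunP => x; apply: val_inj; rewrite /= sub_inclE ?id_lfunE. Qed.

Lemma sub_incl_comp K (S T U : chain_subcomplex K) q :
    (S q <= T q)%VS -> (T q <= U q)%VS ->
  sub_incl S U q = (sub_incl T U q \o sub_incl S T q)%VF.
Proof.
move=> ST TU; apply/lfunP => x; apply: val_inj.
by rewrite /= comp_lfunE !sub_inclE // (subv_trans ST).
Qed.

End Homology.

(** * Cell complexes *)

Record cell_complex (F : fieldType) := CellComplex {
  cells :> finType;
  cdim : cells -> nat;
  kappa : cells -> cells -> F;
  kappa_dim : forall t s, kappa t s != 0 -> cdim t = (cdim s).+1;
  kappa_comp : forall t s, \sum_r kappa t r * kappa r s = 0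
}.

Section CellComplex.

Variables (F : fieldType) (X : cell_complex F).

Definition cell q : finType := {x : X | cdim x == q}.

Definition cell_le : rel X := connect (fun s t => kappa t s != 0).

Definition chain q : vectType F := {ffun cell q -> F^o}.

Definition cell_basis q (s : cell q) : chain q := [ffun t => (t == s)%:R].

Definition bd_fun q (c : chain q.+1) : chain q :=
  [ffun s => \sum_t c t * kappa (val t) (val s)].

Fact bd_fun_linear q : linear (@bd_fun q).
Proof.
move=> a c d; apply/ffunP => s; rewrite !ffunE scaler_sumr -big_split /=.
by apply: eq_bigr => t _; rewrite !ffunE mulrDl -mulrA.
Qed.
HB.instance Definition _ q := GRing.isLinear.Build F (chain q.+1) (chain q) _
  (@bd_fun q) (@bd_fun_linear q).

Definition bd q : 'Hom(chain q.+1, chain q) := linfun (@bd_fun q).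

Lemma bd_basis q (t : cell q.+1) :
  bd q (cell_basis t) = \sum_s kappa (val t) (val s) *: cell_basis s.
Proof.
rewrite lfunE; apply/ffunP => s; rewrite sum_ffunE !ffunE.
rewrite (bigD1 t) //= big1 ?addr0 => [|r /negPf rt]; last first.
  by rewrite ffunE rt mul0r.
rewrite (bigD1 s) //= big1 ?addr0 => [|r /negPf rs]; last first.
  by rewrite !ffunE eq_sym rs scaler0.
by rewrite !ffunE !eqxx mul1r [RHS]mulr1.
Qed.

Fact bd_comp q : (bd q \o bd q.+1)%VF = 0.
Proof.
apply/lfunP => c; rewrite zero_lfunE comp_lfunE !lfunE /=.
apply/ffunP => s; rewrite !ffunE.
under eq_bigr do rewrite ffunE mulr_suml.
rewrite exchange_big big1 //= => t _.
under eq_bigr do rewrite -mulrA.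
rewrite -mulr_sumr; set S := (X in _ * X); suff -> : S = 0 by rewrite mulr0.
rewrite -(kappa_comp (val t) (val s)) /S.
rewrite [RHS](bigID (fun r : X => cdim r == q.+1)) /= addrC.
rewrite [X in _ = X + _]big1 ?add0r => [|r rq]; last first.
  have [->|/kappa_dim] := eqVneq (kappa (val t) r) 0; first by rewrite mul0r.
  by rewrite (eqP (valP t)) => -[rE]; rewrite -rE eqxx in rq.
rewrite [RHS](reindex_omap val (insub : X -> option (cell q.+1))) /=.
  by apply: eq_bigl => r; rewrite (valP r) valK eqxx.
by move=> r rq; rewrite insubT.
Qed.

Definition chain_cx : chain_complex F := @ChainComplex F chain bd bd_comp.

Definition chain_in (A : {set X}) q : {vspace chain q} :=
  (\sum_(s : cell q | val s \in A) <[cell_basis s]>)%VS.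

Record subcomplex := Subcomplex {
  subcells :> {set X};
  subcellsP : forall q,
    (bd q @: chain_in subcells q.+1 <= chain_in subcells q)%VS
}.

Lemma chain_inS (A B : {set X}) q :
  A \subset B -> (chain_in A q <= chain_in B q)%VS.
Proof.
move=> /subsetP AB; apply/subv_sumP => s /AB sB.
by rewrite (sumv_sup s).
Qed.

Fact bigcup_subcomplexP (I : finType) (A : I -> subcomplex) q :
  (bd q @: chain_in (\bigcup_i A i) q.+1 <= chain_in (\bigcup_i A i) q)%VS.
Proof.
rewrite limg_sum; apply/subv_sumP => s /bigcupP[i _ sA].
apply: subv_trans (chain_inS q (bigcup_sup i _)) => //.
by apply: subv_trans (subcellsP (A i) q); rewrite limgS // (sumv_sup s).
Qed.
Definition bigcup_subcomplex (I : finType) (A : I -> subcomplex) : subcomplex :=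
  Subcomplex (bigcup_subcomplexP A).

Definition subcx (A : subcomplex) : chain_subcomplex chain_cx :=
  @ChainSubcomplex F chain_cx (chain_in A) (subcellsP A).

Definition chains (A : subcomplex) : chain_complex F := sub_complex (subcx A).

(* C(A) / C(B), when B is contained in A. *)
Definition rel_chains (A B : subcomplex) : chain_complex F :=
  quot_complex (sub_in (subcx A) (subcx B)).

End CellComplex.

(** * Persistence modules, Koszul complexes and Betti tables *)

Definition grade_le n (u v : 'rV[int]_n) : bool := [forall i, u 0 i <= v 0 i].

Definition unit_grade n (j : 'I_n) : 'rV[int]_n := delta_mx 0 j.
Definition set_grade n (s : {set 'I_n}) : 'rV[int]_n :=
  \sum_(j in s) unit_grade j.

Lemma grade_le_refl n : reflexive (@grade_le n).
Proof. by move=> u; apply/forallP. Qed.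

Lemma grade_le_subset n (u : 'rV[int]_n) (s t : {set 'I_n}) :
  t \subset s -> grade_le (u - set_grade s) (u - set_grade t).
Proof.
move=> ts; apply/forallP => i; rewrite !mxE lerD2l lerN2.
rewrite /set_grade !summxE [X in _ <= X](big_setID t) /= (setIidPr ts) lerDl sumr_ge0 // => j _.
by rewrite mxE eqxx /= ler0n.
Qed.

(* [pm_map u v] is meaningful only for [u] below [v]. *)
Record pers_module (F : fieldType) (n : nat) := PersModule {
  pm_sp :> 'rV[int]_n -> vectType F;
  pm_map : forall u v, 'Hom(pm_sp u, pm_sp v);
  pm_map_id : forall u, pm_map u u = \1%VF;
  pm_map_comp : forall u v w, grade_le u v -> grade_le v w ->
    pm_map u w = (pm_map v w \o pm_map u v)%VF
}.

Section Koszul.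

Variables (F : fieldType) (n : nat) (V : pers_module F n) (u : 'rV[int]_n).

Definition ksub i : finType := {s : {set 'I_n} | #|s| == i}.

Definition koszul_sp i : vectType F :=
  dsum (fun s : ksub i => V (u - set_grade (val s))).

(* When [s] is [j_1 < ... < j_i] and [j = j_(i-r)], exactly [r] elements of [s]
   are larger than [j]. *)
Definition koszul_sign (s : {set 'I_n}) (j : 'I_n) : F :=
  (-1) ^+ #|[set k in s | (j < k)%N]|.

Definition koszul_diff_fun i (a : koszul_sp i.+1) : koszul_sp i :=
  dsum_mk (fun t : ksub i =>
    \sum_(s : ksub i.+1) \sum_(j in val s | val t == val s :\ j)
      koszul_sign (val s) j *:
        pm_map V (u - set_grade (val s)) (u - set_grade (val t))
          (dsum_val a s)).

Fact koszul_diff_linear i : linear (@koszul_diff_fun i).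
Proof.
move=> c a b; apply: dsumP => t.
rewrite dsumDE dsumZE !dsum_mkE scaler_sumr -big_split /=.
apply: eq_bigr => s _; rewrite scaler_sumr -big_split /=.
apply: eq_bigr => j _; rewrite dsumDE dsumZE linearP scalerDr !scalerA.
by rewrite [c * _]mulrC.
Qed.
HB.instance Definition _ i := GRing.isLinear.Build F (koszul_sp i.+1)
  (koszul_sp i) _ (@koszul_diff_fun i) (@koszul_diff_linear i).

Definition koszul_diff i : 'Hom(koszul_sp i.+1, koszul_sp i) :=
  linfun (@koszul_diff_fun i).

Lemma koszul_signN (s : {set 'I_n}) (j k : 'I_n) : j \in s -> k \in s ->
    (j < k)%N ->
  koszul_sign s k * koszul_sign (s :\ k) j =
  - (koszul_sign s j * koszul_sign (s :\ j) k).
Proof.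
move=> js ks jk; rewrite /koszul_sign.
have -> : [set l in s :\ j | (k < l)%N] = [set l in s | (k < l)%N].
  apply/setP => l; rewrite !inE; case: (eqVneq l j) => [->|] //=.
  by rewrite ltnNge (ltnW jk) andbF.
have -> : [set l in s | (j < l)%N] = k |: [set l in s :\ k | (j < l)%N].
  apply/setP => l; rewrite !inE; case: (eqVneq l k) => [->|] //=.
  by rewrite ks jk.
by rewrite cardsU1 !inE eqxx /= exprS mulN1r mulNr opprK mulrC.
Qed.

Lemma sum_antisym (g : 'I_n -> 'I_n -> F) : (forall j, g j j = 0) ->
    (forall j k : 'I_n, (j < k)%N -> g j k = - g k j) ->
  \sum_j \sum_k g j k = 0.
Proof.
move=> g0 gN.
have gE j : \sum_k g j k =
    \sum_(k : 'I_n | (j < k)%N) g j k + \sum_(k : 'I_n | (k < j)%N) g j k.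
  rewrite (bigID (fun k : 'I_n => (j < k)%N)) /=; congr (_ + _).
  rewrite [LHS]big_mkcond [RHS]big_mkcond; apply: eq_bigr => k _.
  rewrite -leqNgt leq_eqVlt; case: (eqVneq (k : nat) j) => [/val_inj ->|] //=.
  by rewrite ltnn g0.
under eq_bigr do rewrite gE.
rewrite big_split /= addrC (exchange_big_dep xpredT) //= -big_split big1 //= => j _.
rewrite -big_split; apply: big1 => k jk /=.
by rewrite (gN j k) ?subrr.
Qed.

Lemma koszul_coef0 i (s : ksub i.+2) (r : ksub i) :
  \sum_(t : ksub i.+1) \sum_(k in val t | val r == val t :\ k)
    \sum_(j in val s | val t == val s :\ j)
      koszul_sign (val t) k * koszul_sign (val s) j = 0.
Proof.
pose S : {set 'I_n} := val s; pose c (t : {set 'I_n}) k j := koszul_sign t k * koszul_sign S j.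
pose P (t : {set 'I_n}) k j := [&& k \in t, val r == t :\ k, j \in S & t == S :\ j].
pose g k j := if P (S :\ j) k j then c (S :\ j) k j else 0.
transitivity (\sum_(t : ksub i.+1) \sum_k \sum_j
    if P (val t) k j then c (val t) k j else 0).
  apply: eq_bigr => t _; rewrite big_mkcond; apply: eq_bigr => k _.
  rewrite /P; case: (k \in _) => /=; last by rewrite big1.
  case: (_ == _) => /=; last by rewrite big1.
  by rewrite big_mkcond.
rewrite exchange_big; under eq_bigr do rewrite exchange_big /=.
transitivity (\sum_k \sum_j g k j).
  apply: eq_bigr => k _; apply: eq_bigr => j _; rewrite /g.
  case: (boolP (j \in S)) => jS; last first.
    by rewrite /P (negPf jS) !andbF big1 // => t _; rewrite !andbF.
  have tP : #|S :\ j| == i.+1.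
    by have := cardsD1 j S; rewrite jS (eqP (valP s)) add1n => -[->].
  rewrite (bigD1 (Sub (S :\ j) tP)) //= big1 ?addr0 // => t.
  rewrite -val_eqE /= => /negPf tN; rewrite /P.
  by rewrite [val t == _]tN !andbF.
apply: sum_antisym => [j | j k jk]; rewrite /g /P.
  by rewrite !inE eqxx.
rewrite !inE !eqxx !andbT (eq_sym k j) !(neq_ltn j k) jk /=.
rewrite [S :\ k :\ j]setDDl [S :\ j :\ k]setDDl setUC.
case: (boolP (j \in S)) => jS; case: (boolP (k \in S)) => kS //=;
  rewrite ?andbF ?oppr0 //.
rewrite ?andbT; case: ifP => _; rewrite ?oppr0 //.
by rewrite /c mulrC koszul_signN // [in RHS]mulrC.
Qed.

Fact koszul_diff_comp i : (koszul_diff i \o koszul_diff i.+1)%VF = 0.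
Proof.
apply/lfunP => a; rewrite zero_lfunE comp_lfunE !lfunE /=.
apply: dsumP => r; rewrite dsum_mkE dsum0E.
pose m (s : ksub i.+2) : V (u - set_grade (val r)) :=
  pm_map V (u - set_grade (val s)) _ (dsum_val a s).
transitivity (\sum_(s : ksub i.+2) (\sum_(t : ksub i.+1)
    \sum_(k in val t | val r == val t :\ k)
    \sum_(j in val s | val t == val s :\ j)
      koszul_sign (val t) k * koszul_sign (val s) j) *: m s); last first.
  by rewrite big1 // => s _; rewrite koszul_coef0 scale0r.
under [RHS]eq_bigr do rewrite scaler_suml.
rewrite [RHS]exchange_big; apply: eq_bigr => t _ /=.
under [RHS]eq_bigr do rewrite scaler_suml.
rewrite [RHS]exchange_big; apply: eq_bigr => k /andP[kt /eqP rE] /=.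
rewrite dsum_mkE (linear_sum (pm_map V _ _)) scaler_sumr; apply: eq_bigr => s _.
rewrite (linear_sum (pm_map V _ _)) scaler_sumr scaler_suml.
apply: eq_bigr => j /andP[js /eqP tE].
have pmZ v w c x : pm_map V v w (c *: x) = c *: pm_map V v w x.
  exact: linearZ.
rewrite /= pmZ scalerA /m -comp_lfunE -pm_map_comp //.
  by apply: grade_le_subset; rewrite tE subD1set.
by apply: grade_le_subset; rewrite rE subD1set.
Qed.

Definition koszul : chain_complex F := 
  @ChainComplex F koszul_sp koszul_diff koszul_diff_comp.

End Koszul.

Definition betti (F : fieldType) (n : nat) (V : pers_module F n) (i : nat)
  (u : 'rV[int]_n) : nat := \dim {: homology (koszul V u) i}.

(** * Filtrations *)

Record filtration (F : fieldType) (X : cell_complex F) (n : nat) := Filtration {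
  fil :> 'rV[int]_n -> subcomplex X;
  fil_mono : forall u v, grade_le u v -> fil u \subset fil v;
  fil_one_critical : exists f : X -> 'rV[int]_n,
    (forall s t, cell_le s t -> grade_le (f s) (f t)) /\
    (forall u, fil u = [set s | grade_le (f s) u] :> {set X});
  fil_bounded_below : forall u, fil u != set0 :> {set X} -> grade_le 0 u;
  fil_exhaustive : exists w, forall u, grade_le w u -> fil u = setT :> {set X}
}.

Section Filtration.

Variables (F : fieldType) (X : cell_complex F) (n : nat) (Xf : filtration X n).

Definition pers_map q u v :
    'Hom(homology (chains (Xf u)) q, homology (chains (Xf v)) q) :=
  homology_map (sub_incl (subcx (Xf u)) (subcx (Xf v))) q.

Fact pers_map_id q u : pers_map q u u = \1%VF.
Proof. by apply: homology_map_id => p; exact: sub_incl_id. Qed.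

Fact pers_map_comp q u v w : grade_le u v -> grade_le v w ->
  pers_map q u w = (pers_map q v w \o pers_map q u v)%VF.
Proof.
move=> uv vw; apply: homology_map_comp => [||p].
- by apply: sub_incl_chain_map => p; apply/chain_inS/fil_mono.
- by apply: sub_incl_chain_map => p; apply/chain_inS/fil_mono.
- by apply: sub_incl_comp; apply/chain_inS/fil_mono.
Qed.

Definition pers_homology q : pers_module F n :=
  PersModule (pers_map_id q) (@pers_map_comp q).

Definition xi q i u : nat := betti (pers_homology q) i u.

Definition mu q (u : 'rV[int]_n) : nat :=
  \dim {: homology (rel_chains (Xf u)
            (bigcup_subcomplex (fun j : 'I_n => Xf (u - unit_grade j)))) q}.

End Filtration.

(* Main.v *)
From HB Require Import structures.
Require Import Defs.
From mathcomp Require Import all_boot all_order all_algebra.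

(** Let [C(s)] be the cellular chains of [X^(u - e_s)], for [s] a set of indices.
One-criticality gives [X^(u - e_s) = \bigcap_(j in s) X^(u - e_j)], so the rows of
the double complex [D_(p,q) = \bigoplus_(#|s| = p) C_q(s)], with Koszul-type
horizontal differential, resolve [C(X^u) / C(\bigcup_j X^(u - e_j))].  The spectral
sequence of the column filtration starts with [E^1_(p,q) = K_p(V_q)(u)], so
[dim E^2_(p,q) = xi_p^q(u)], and converges to the relative homology.  Inside
[H_(p+q)] the edge term [E^oo_(0,q)] is what is left of [E^2_(0,q)] after the
differentials [d^r], whose sources are subquotients of [E^2_(r,q+1-r)] for
[2 <= r <= q+1]; the bound even holds without the term [p = 1].

Instead of the spectral sequence, the proof uses the subspaces [killed r] of the
[q]-cycles of [X^u] that bound a total chain with components in columns at most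
[r], and compares the dimensions of two consecutive ones. *)

Set Implicit Arguments.
Unset Strict Implicit.
Unset Printing Implicit Defensive.

Import Order.TTheory GRing.Theory Num.Theory.

Local Open Scope ring_scope.

(** * Linear algebra: a rank estimate, homology classes, supports *)

(** [P] splits into [P :&: lker g], which [f] sends into [W], and a complement, which [g] embeds
    into [H]. In the applications [H] is a homology space and [g] takes the class of a component. *)
Lemma dim_limg_le (F : fieldType) (U V H : vectType F) (f : 'Hom(U, V))
    (g : 'Hom(U, H)) (P : {vspace U}) (W : {vspace V}) :
    (forall x, x \in P -> g x = 0 -> f x \in W) ->
  (\dim (f @: P) <= \dim W + \dim {:H})%N.
Proof.
move=> fW; rewrite -(addv_diff_cap P (lker g)) addvC limgD.
apply: (leq_trans (dimv_add_leqif _ _)); apply: leq_add.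
  apply/dimvS/subvP => _ /memv_imgP[x xP ->].
  by move: xP; rewrite memv_cap memv_ker => /andP[xP /eqP]; apply: fW.
apply: leq_trans (dimvS (subvf (g @: P))).
apply: (leq_trans (n := \dim (P :\: lker g))).
  by rewrite -(limg_ker_dim f) leq_addl.
by rewrite -(leq_add2l (\dim (P :&: lker g))) limg_ker_dim dimv_cap_compl.
Qed.

Section HomologyClass.
Variable F : fieldType.
Implicit Types K L : chain_complex F.

(** [vsproj] makes this a linear map on all of [K q]; it is the homology class only on cycles. *)
Definition hclass K q : 'Hom(K q, homology K q) :=
  (quotv_pi (boundaries K q) \o linfun (vsproj (cycles K q)))%VF.

Lemma hclassE K q x : hclass K q x = quotv_pi _ (vsproj (cycles K q) x).
Proof. by rewrite comp_lfunE; congr (quotv_pi _ _); exact: lfunE. Qed.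

Lemma hclass_eq0 K q x : x \in cycles K q ->
  (hclass K q x == 0) = (x \in limg (diff K q)).
Proof.
move=> xZ; rewrite hclassE -memv_ker quotv_pi_ker -memv_preim lfunE /=.
by rewrite vsprojK.
Qed.

Lemma hclass_surj K q h : exists2 x, x \in cycles K q & hclass K q x = h.
Proof.
have : h \in limg (quotv_pi (boundaries K q)) by rewrite quotv_pi_surj memvf.
case/memv_imgP => z _ ->; exists (vsval z); first exact: subvsP.
by rewrite hclassE vsvalK.
Qed.

Lemma homology_map_hclass K L (f : forall q, 'Hom(K q, L q)) q x :
    chain_map f -> x \in cycles K q ->
  homology_map f q (hclass K q x) = hclass L q (f q x).
Proof.
move=> fC xZ; rewrite !hclassE homology_mapE //; congr (quotv_pi _ _).
have fZ := chain_map_cycles fC q.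
apply: val_inj; rewrite /= subvs_mapE // !vsprojK //.
by apply: (subvP fZ); rewrite memv_img.
Qed.

Lemma diff_cycles K q x : diff K q x \in cycles K q.
Proof. by case: q x => [|q] x; rewrite ?memvf //= memv_ker diff_diff. Qed.

End HomologyClass.

Section Supp.
Variables (F : fieldType) (I : finType).
Notation M := {ffun I -> F^o}.

Definition restrict_fun (S : pred I) (x : M) : M := [ffun i => if S i then x i else 0].

Fact restrict_linear S : linear (restrict_fun S).
Proof.
by move=> a x y; apply/ffunP => i; rewrite !ffunE; case: ifP; rewrite ?scaler0 ?addr0.
Qed.
HB.instance Definition _ S := GRing.isLinear.Build F M M _
  (restrict_fun S) (restrict_linear S).

Definition restrict S : 'End(M) := linfun (restrict_fun S).

Lemma restrictE S x i : restrict S x i = if S i then x i else 0.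
Proof. by rewrite lfunE /= ffunE. Qed.

Definition supp (S : pred I) : {vspace M} := lker (restrict (predC S)).

Lemma suppP (S : pred I) (x : M) : reflect (forall i, x i != 0 -> S i) (x \in supp S).
Proof.
rewrite memv_ker; apply: (iffP eqP) => [x0 i | xS].
  by apply: contraNT => Si; move/ffunP/(_ i): x0; rewrite restrictE ffunE /= Si => ->.
apply/ffunP => i; rewrite restrictE ffunE /=; case: ifP => // Si.
by apply/eqP/negPn; apply: contraNN Si; apply: xS.
Qed.

End Supp.

(** * The double complex *)

Section DoubleComplex.

Variables (F : fieldType) (X : cell_complex F) (n : nat).

(* All bidegrees and all grades live in this single space; [D_(p,q)] is cut out
   below as the chains with a prescribed support. *)
Notation M := {ffun {set 'I_n} * X -> F^o}.
Notation sg := (koszul_sign F).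

Definition cbd_fun (x : M) : M :=
  [ffun i : {set 'I_n} * X => \sum_t x (i.1, t) * kappa t i.2].

Fact cbd_linear : linear cbd_fun.
Proof.
move=> a x y; apply/ffunP => i; rewrite !ffunE scaler_sumr -big_split /=.
by apply: eq_bigr => t _; rewrite !ffunE mulrDl -mulrA.
Qed.
HB.instance Definition _ := GRing.isLinear.Build F M M _ cbd_fun cbd_linear.
Definition cbd : 'End(M) := linfun cbd_fun.

Lemma cbdE (x : M) (i : {set 'I_n} * X) :
  cbd x i = \sum_t (x (i.1, t) : F) * kappa t i.2 :> F.
Proof. by rewrite lfunE ffunE. Qed.

(** The Koszul differential on chains, read off at its target [t]: the sources are the sets
    [j |: t]. Inclusions are the identity on cells, so only the signs remain. *)
Definition kbd_fun (x : M) : M :=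
  [ffun i : {set 'I_n} * X =>
     \sum_(j | j \notin i.1) sg (j |: i.1) j * x (j |: i.1, i.2)].

Fact kbd_linear : linear kbd_fun.
Proof.
move=> a x y; apply/ffunP => i; rewrite !ffunE scaler_sumr -big_split /=.
by apply: eq_bigr => t _; rewrite !ffunE mulrDr mulrCA.
Qed.
HB.instance Definition _ := GRing.isLinear.Build F M M _ kbd_fun kbd_linear.
Definition kbd : 'End(M) := linfun kbd_fun.

Lemma kbdE (x : M) (i : {set 'I_n} * X) :
  kbd x i = \sum_(j | j \notin i.1) sg (j |: i.1) j * (x (j |: i.1, i.2) : F) :> F.
Proof. by rewrite lfunE ffunE. Qed.

(* [cbd] and [kbd] commute; twisting [kbd] by this sign makes [tot] a differential. *)
Definition eps_fun (x : M) : M := [ffun i : {set 'I_n} * X => (-1) ^+ cdim i.2 * x i].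

Fact eps_linear : linear eps_fun.
Proof. by move=> a x y; apply/ffunP => i; rewrite !ffunE mulrDr mulrCA. Qed.
HB.instance Definition _ := GRing.isLinear.Build F M M _ eps_fun eps_linear.
Definition eps : 'End(M) := linfun eps_fun.

Lemma epsE (x : M) (i : {set 'I_n} * X) : eps x i = (-1) ^+ cdim i.2 * (x i : F) :> F.
Proof. by rewrite lfunE ffunE. Qed.

Lemma eps_cbd x : eps (cbd x) = - cbd (eps x).
Proof.
apply/ffunP => i; rewrite epsE cbdE ffunE cbdE mulr_sumr -sumrN.
apply: eq_bigr => t _; rewrite epsE.
have [->|/kappa_dim ->] := eqVneq (kappa t i.2) 0; first by rewrite !mulr0 oppr0.
by rewrite exprS mulN1r !mulNr opprK mulrA.
Qed.

Lemma eps_kbd x : eps (kbd x) = kbd (eps x).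
Proof.
apply/ffunP => i; rewrite epsE !kbdE mulr_sumr.
by apply: eq_bigr => j _; rewrite epsE mulrCA.
Qed.

Lemma epsK x : eps (eps x) = x.
Proof. by apply/ffunP => i; rewrite !epsE mulrA -expr2 sqrr_sign mul1r. Qed.

Lemma cbd_kbd x : cbd (kbd x) = kbd (cbd x).
Proof.
apply/ffunP => i; rewrite cbdE kbdE.
under eq_bigr do rewrite kbdE mulr_suml.
rewrite /= exchange_big; apply: eq_bigr => j _ /=.
by rewrite cbdE mulr_sumr; apply: eq_bigr => t _; rewrite mulrA.
Qed.

Lemma cbd_cbd x : cbd (cbd x) = 0.
Proof.
apply/ffunP => i; rewrite cbdE ffunE.
under eq_bigr do rewrite cbdE mulr_suml.
rewrite exchange_big big1 //= => r _.
under eq_bigr do rewrite -mulrA.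
by rewrite -mulr_sumr kappa_comp mulr0.
Qed.

(** The terms that reach [t] from [k |: (j |: t)] through [j |: t] and through [k |: t] cancel by
    [koszul_signN]. *)
Lemma kbd_kbd x : kbd (kbd x) = 0.
Proof.
apply/ffunP => -[t s]; rewrite kbdE ffunE /=.
pose g j k : F := if [&& j != k, j \notin t & k \notin t] then
  sg (j |: t) j * (sg (k |: (j |: t)) k * x (k |: (j |: t), s)) else 0.
transitivity (\sum_j \sum_k g j k).
  rewrite big_mkcond; apply: eq_bigr => j _.
  case: ifP => jt; last by rewrite big1 // => k _; rewrite /g jt andbF.
  rewrite kbdE mulr_sumr big_mkcond; apply: eq_bigr => k _ /=.
  by rewrite !inE negb_or eq_sym /g jt.
apply: sum_antisym => [j | j k jk]; rewrite /g ?eqxx //.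
have njk : j != k by rewrite neq_ltn jk.
rewrite [k == j]eq_sym njk /=.
case: (boolP (j \in t)) => jt; case: (boolP (k \in t)) => kt; rewrite ?oppr0 //=.
rewrite [j |: (k |: t)]setUCA !mulrA -mulNr; congr (_ * _).
have := koszul_signN F (s := k |: (j |: t)) _ _ jk.
rewrite !inE !eqxx orbT setU1K ?inE ?negb_or 1?eq_sym ?njk //.
rewrite [k |: (j |: t)]setUCA setU1K ?inE ?negb_or ?njk //.
move=> /(_ isT isT); rewrite mulrC => ->; by rewrite mulrC.
Qed.

Definition tot : 'End(M) := (cbd + (eps \o kbd))%VF.

Lemma totE x : tot x = cbd x + eps (kbd x).
Proof. by rewrite  add_lfunE comp_lfunE. Qed.

Lemma tot_tot x : tot (tot x) = 0.
Proof.
rewrite !totE !linearD /= cbd_cbd add0r.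
rewrite -[kbd (eps _)]eps_kbd kbd_kbd !linear0 addr0 -cbd_kbd eps_cbd.
by rewrite subrr.
Qed.

End DoubleComplex.

Arguments cbd {F X n}.
Arguments kbd {F X n}.
Arguments eps {F X n}.
Arguments tot {F X n}.

(** * The filtered double complex and the exactness of its rows *)

Section Filtered.

Variables (F : fieldType) (X : cell_complex F) (n : nat).
Variables (Xf : filtration X n) (u : 'rV[int]_n).

Notation I := ({set 'I_n} * X)%type.
Notation M := {ffun {set 'I_n} * X -> F^o}.
Notation sg := (koszul_sign F).
Notation Xs s := (Xf (u - set_grade s)).
Notation A := (bigcup_subcomplex (fun j : 'I_n => Xf (u - unit_grade j))).

Lemma fil_closed v s t : kappa t s != 0 -> t \in Xf v -> s \in Xf v.
Proof.
have [f [f_le fE]] := fil_one_critical Xf; rewrite !fE !inE => ts tv.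
have /forallP st : grade_le (f s) (f t) by apply/f_le/connect1.
by apply/forallP => i; apply: le_trans (st i) (forallP tv i).
Qed.

(** By one-criticality, membership is an inequality of grades and can be tested one coordinate at a
    time: coordinate [j] is governed by [unit_grade j], every other one by [t]. *)
Lemma fil_setU1 s (t : {set 'I_n}) j : j \notin t -> s \in Xs t ->
  s \in Xf (u - unit_grade j) -> s \in Xs (j |: t).
Proof.
have [f [_ fE]] := fil_one_critical Xf; rewrite !fE !inE => jt /forallP st /forallP sj.
have tE (w : {set 'I_n}) k : set_grade w 0 k = (k \in w)%:R.
  rewrite summxE; case: (boolP (k \in w)) => kw.
    rewrite (bigD1 k) //= mxE !eqxx big1 ?addr0 // => l /andP[_ lk].
    by rewrite mxE eq_sym (negPf lk) andbF.
  rewrite big1 // => l lw; rewrite mxE eqxx /=.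
  by case: eqVneq => [kl|] //; rewrite kl lw in kw.
apply/forallP => k; rewrite !mxE tE !inE.
case: eqVneq => [->|_] /=.
  by have := sj j; rewrite !mxE !eqxx.
by have := st k; rewrite !mxE tE.
Qed.

Lemma fil_set1 s (t : {set 'I_n}) : t != set0 -> s \in Xs t -> s \in A.
Proof.
case/set0Pn => j jt sX; apply/bigcupP; exists j => //.
apply: (subsetP (fil_mono Xf _)) sX.
by rewrite -[unit_grade j](big_set1 +%R) grade_le_subset // sub1set.
Qed.

(** [bideg p q] is D_(p,q), and [totfil r m] is stage [r] of the column filtration of the total
    complex in degree [m]. *)
Definition bideg (p q : nat) : {vspace M} :=
  supp F [pred i : I | [&& #|i.1| == p, cdim i.2 == q & i.2 \in Xs i.1]].
Definition totfil (r m : nat) : {vspace M} :=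
  supp F [pred i : I | [&& (#|i.1| <= r)%N, #|i.1| + cdim i.2 == m & i.2 \in Xs i.1]%N].
Definition proj (p : nat) : 'End(M) := restrict F [pred i : I | #|i.1| == p].

Lemma cbd_bideg p q x : x \in bideg p q.+1 -> cbd x \in bideg p q.
Proof.
move/suppP => xS; apply/suppP => -[t s]; rewrite cbdE /=; apply: contraR => tsS.
rewrite big1 // => r _; have [->|xr] := eqVneq (x (t, r)) 0; first by rewrite mul0r.
have [->|rs] := eqVneq (kappa r s) 0; first by rewrite mulr0.
case/and3P: (xS _ xr) tsS => /= -> rq rX; rewrite (fil_closed rs rX) andbT /=.
by move: (eqP rq); rewrite (kappa_dim rs) => -[->]; rewrite eqxx.
Qed.

Lemma kbd_bideg p q x : x \in bideg p.+1 q -> kbd x \in bideg p q.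
Proof.
move/suppP => xS; apply/suppP => -[t s]; rewrite kbdE /=; apply: contraR => tsS.
rewrite big1 // => j jt; have [->|xj] := eqVneq (x (j |: t, s)) 0; first by rewrite mulr0.
case/and3P: (xS _ xj) tsS => /=; rewrite cardsU1 jt eqSS => -> -> sX /=.
by rewrite (subsetP (fil_mono Xf (grade_le_subset _ (subsetUr _ _))) _ sX).
Qed.

Lemma eps_supp S (x : M) : x \in supp F S -> eps x \in supp F S.
Proof.
move/suppP => xS; apply/suppP => i; rewrite epsE => xi; apply: xS.
by apply: contraNN xi => /eqP ->; rewrite mulr0.
Qed.

Lemma eps_bideg p q x : x \in bideg p q -> eps x \in bideg p q.
Proof. exact: eps_supp. Qed.

Lemma kbd_bideg0 q x : x \in bideg 0 q -> kbd x = 0.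
Proof.
move/suppP => xS; apply/ffunP => -[t s]; rewrite kbdE ffunE big1 // => j jt.
have [->|xj] := eqVneq (x (j |: t, s)) 0; first by rewrite mulr0.
by case/and3P: (xS _ xj) => /=; rewrite cardsU1 jt.
Qed.

Lemma cbd_bideg0 p x : x \in bideg p 0 -> cbd x = 0.
Proof.
move/suppP => xS; apply/ffunP => -[t s]; rewrite cbdE ffunE big1 // => r _.
have [->|xr] := eqVneq (x (t, r)) 0; first by rewrite mul0r.
have [->|rs] := eqVneq (kappa r s) 0; first by rewrite mulr0.
by case/and3P: (xS _ xr) => /=; rewrite (kappa_dim rs).
Qed.

Lemma bideg_totfil p q r x : (p <= r)%N -> x \in bideg p q -> x \in totfil r (p + q).
Proof.
move=> pr /suppP xS; apply/suppP => i /xS /and3P[/= /eqP-> /eqP-> ->].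
by rewrite pr eqxx.
Qed.

Lemma totfilW r r' m x : (r <= r')%N -> x \in totfil r m -> x \in totfil r' m.
Proof.
move=> rr' /suppP xS; apply/suppP => i /xS /and3P[/= ir -> ->].
by rewrite (leq_trans ir).
Qed.

Lemma proj_cbd p (x : M) : proj p (cbd x) = cbd (proj p x).
Proof.
apply/ffunP => i; rewrite restrictE !cbdE /=.
case: ifP => ip; last by rewrite big1 // => t _; rewrite restrictE /= ip mul0r.
by apply: eq_bigr => t _; rewrite restrictE /= ip.
Qed.

Lemma proj_kbd p (x : M) : proj p (kbd x) = kbd (proj p.+1 x).
Proof.
apply/ffunP => i; rewrite restrictE !kbdE /=.
case: ifP => ip; last first.
  by rewrite big1 // => j ji; rewrite restrictE /= cardsU1 ji eqSS ip mulr0.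
by apply: eq_bigr => j ji; rewrite restrictE /= cardsU1 ji eqSS ip.
Qed.

Lemma proj_eps p (x : M) : proj p (eps x) = eps (proj p x).
Proof.
by apply/ffunP => i; rewrite !(restrictE, epsE); case: ifP; rewrite ?mulr0.
Qed.

Lemma proj_tot p (x : M) :
  proj p (tot x) = cbd (proj p x) + eps (kbd (proj p.+1 x)).
Proof. by rewrite totE linearD /= proj_cbd proj_eps proj_kbd. Qed.

Lemma proj_bideg r p q x : x \in totfil r (p + q) -> proj p x \in bideg p q.
Proof.
move/suppP => xS; apply/suppP => i; rewrite restrictE /=.
case: (#|i.1| =P p) => [ip xi|]; last by rewrite eqxx.
by case/and3P: (xS _ xi) => /= _; rewrite ip eqn_add2l => -> ->.
Qed.

Lemma proj_totfil_gt r m p x : (r < p)%N -> x \in totfil r m -> proj p x = 0.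
Proof.
move=> rp /suppP xS; apply/ffunP => i; rewrite restrictE ffunE /=.
case: eqP => // ip; apply/eqP; apply: contraLR rp => xi; rewrite -leqNgt.
by case/and3P: (xS _ xi); rewrite -ip.
Qed.

Lemma totfil_subproj r m x : x \in totfil r.+1 m -> x - proj r.+1 x \in totfil r m.
Proof.
move/suppP => xS; apply/suppP => i; rewrite !ffunE restrictE /=.
case: ifPn => ir; first by rewrite subrr eqxx.
rewrite subr0 => /xS /and3P[/= ir1 -> ->]; rewrite !andbT.
by rewrite -ltnS ltn_neqAle ir.
Qed.

Lemma koszul_sign_sqr (t : {set 'I_n}) j : sg t j * sg t j = 1.
Proof. by rewrite /koszul_sign -expr2 sqrr_sign. Qed.

(** [koszul_signN] rearranged, using that signs square to 1; the relation is symmetric in [j] and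
    [k], so [j < k] may be assumed. It compares adding [j] and removing [k] in the two orders. *)
Lemma koszul_sign_swap (t : {set 'I_n}) j k : j \in t -> k \in t -> j != k ->
  sg t j * sg t k = - (sg (t :\ j) k * sg (t :\ k) j).
Proof.
wlog jk : j k / (j < k)%N => [W jt kt njk|jt kt _].
  case: (ltngtP j k) => [/W -> //|/W W' | /val_inj jk].
    by rewrite mulrC W' 1?eq_sym // mulrC.
  by rewrite jk eqxx in njk.
rewrite -[LHS]mulr1 -(koszul_sign_sqr (t :\ k) j) mulrA -[_ * sg t k * _]mulrA.
rewrite koszul_signN // mulrN mulrA koszul_sign_sqr mul1r.
by rewrite mulNr.
Qed.

(* The contracting homotopy adds to the index set some [k] with [s] in
   [X^(u - e_k)], chosen as a function of the cell [s] only. *)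
Lemma row_exact p q a : a \in bideg p q -> kbd a = 0 ->
  (forall i, a i != 0 -> i.2 \in A) -> exists2 b, b \in bideg p.+1 q & kbd b = a.
Proof.
move=> /suppP aS da aA.
pose c (s : X) : option 'I_n := [pick j | s \in Xf (u - unit_grade j)].
pose b : M := [ffun i : I => if c i.2 is Some k then
  if k \in i.1 then (sg i.1 k : F) * (a (i.1 :\ k, i.2) : F) else 0 else 0].
have bE i : b i = if c i.2 is Some k then
  if k \in i.1 then (sg i.1 k : F) * (a (i.1 :\ k, i.2) : F) else 0 else 0 :> F.
  by rewrite ffunE.
have cP s k : c s = Some k -> s \in Xf (u - unit_grade k).
  by rewrite /c; case: pickP => // k' ? [<-].
exists b.
  apply/suppP => -[t s]; rewrite bE /=.
  case cs: (c s) => [k|]; last by rewrite eqxx.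
  case: ifP => kt; last by rewrite eqxx.
  rewrite mulf_eq0 negb_or => /andP[_ /aS/and3P[/= tp -> sX]].
  rewrite (cardsD1 k t) kt eqSS tp -(setD1K kt) fil_setU1 ?cP //.
  by rewrite !inE eqxx.
apply/ffunP => -[t s]; rewrite kbdE /=.
case cs: (c s) => [k|]; last first.
  (* A cell without a chosen index lies outside [A], where [a] vanishes. *)
  rewrite big1 => [|j _]; last by rewrite bE cs mulr0.
  apply/esym/eqP; apply: contraPT cs => /aA /bigcupP[j _ sj].
  by rewrite /c; case: pickP => // /(_ j); rewrite sj.
under eq_bigr do rewrite bE /= cs !inE.
have [kt|kt] := boolP (k \in t); last first.
  (* For [k] outside [t], only [j = k] produces a set containing [k]. *)
  rewrite (bigD1 k) //= eqxx /= mulrA koszul_sign_sqr mul1r setU1K // big1 ?addr0 // => j.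
  by case/andP=> _ jk; rewrite eq_sym (negPf jk) mulr0.
(* For [k] in [t], the equation [kbd a = 0] at [t :\ k] is solved for the value of [a] at [t]. *)
move/ffunP/(_ (t :\ k, s)): da; rewrite kbdE ffunE /=.
rewrite (bigD1 k) ?inE ?eqxx //= setD1K //.
move/(congr1 ( *%R (sg t k : F))); rewrite mulrDr mulrA koszul_sign_sqr mul1r mulr0.
move/eqP; rewrite addr_eq0 => /eqP ->; rewrite mulr_sumr -sumrN.
rewrite [RHS](eq_bigl (fun j => j \notin t)) => [|j]; last first.
  by rewrite !inE; case: (eqVneq j k) => [->|]; rewrite ?kt ?andbF ?andbT.
apply: eq_bigr => j jt; have jk : j != k by apply: contraNneq jt => ->.
rewrite orbT.
have tjk : (j |: t) :\ k = j |: (t :\ k).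
  apply/setP => l; rewrite !inE; case: (eqVneq l j) => [->|] //=.
  by rewrite jk.
rewrite tjk !mulrA -mulNr; congr (_ * _).
by rewrite koszul_sign_swap ?inE ?eqxx ?kt ?orbT // setU1K // tjk.
Qed.

(** A staircase: if [kbd b = a], then [tot (eps b)] is [a] plus the error [cbd (eps b)], which lies
    one column further and one cell dimension lower. Induction on [k] removes the error; on 0-cells
    there is none. *)
Lemma tot_zigzag p k a : a \in bideg p k -> kbd a = 0 -> cbd a = 0 ->
    (forall i, a i != 0 -> i.2 \in A) ->
  exists2 x, x \in totfil (p + k).+1 (p + k).+1 & tot x = a.
Proof.
elim: k p a => [|k IHk] p a aD ka ca aA; have [b bD ba] := row_exact aD ka aA;
    have ebD := eps_bideg bD.
  exists (eps b).
    by have := bideg_totfil (leqnn _) ebD; rewrite addSn !addn0.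
  by rewrite totE (cbd_bideg0 ebD) add0r eps_kbd epsK.
pose a' := cbd (eps b).
have a'D : a' \in bideg p.+1 k by apply: cbd_bideg.
have [||i|x xT xE] := IHk _ _ a'D.
- by rewrite -cbd_kbd -eps_kbd ba; apply: oppr_inj; rewrite -eps_cbd ca !linear0.
- exact: cbd_cbd.
(* The index sets in column [p.+1] are nonempty, so cells there lie in [A] automatically. *)
- move/suppP: a'D => /[apply] /and3P[/= i1 _].
  by apply: fil_set1; rewrite -card_gt0 (eqP i1).
exists (eps b - x); last by rewrite linearB /= totE xE eps_kbd epsK ba addrC addKr.
rewrite memvB //; last by rewrite addnS -addSn.
by apply: totfilW (bideg_totfil (leqnn _) ebD); rewrite ltnS leq_addr.
Qed.

End Filtered.

Arguments proj {F X n} p.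

(** * Homology classes of chains *)

Section SubcomplexClasses.

Variables (F : fieldType) (K : chain_complex F).
Implicit Types S T : chain_subcomplex K.

(** As a map on all of [K q] it is linear, but it is a class in the homology of [S] only on cycles
    that lie in [S]. *)
Definition sclass S q : 'Hom(K q, homology (sub_complex S) q) :=
  (hclass (sub_complex S) q \o linfun (vsproj (S q)))%VF.

Lemma sclassE S q c : sclass S q c = hclass (sub_complex S) q (vsproj (S q) c).
Proof. by rewrite comp_lfunE; congr (hclass _ _ _); exact: lfunE. Qed.

Lemma vsproj_cycles S q c : c \in S q -> c \in cycles K q ->
  vsproj (S q) c \in cycles (sub_complex S) q.
Proof.
case: q c => [|q] c cS; first by rewrite !memvf.
rewrite /= !memv_ker => /eqP dc; apply/eqP/val_inj.
by rewrite /= subvs_mapE ?sub_spP //= vsprojK // dc.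
Qed.

Lemma sclass_eq0 S q c : c \in S q -> c \in cycles K q -> sclass S q c = 0 ->
  exists2 y, y \in S q.+1 & diff K q y = c.
Proof.
move=> cS cZ; rewrite sclassE => /eqP; rewrite hclass_eq0 ?vsproj_cycles //.
case/memv_imgP => y _ yE; exists (vsval y); first exact: subvsP.
by rewrite -[RHS](vsprojK cS) yE subvs_mapE ?sub_spP.
Qed.

Lemma sclass_diff S q y : y \in S q.+1 -> sclass S q (diff K q y) = 0.
Proof.
move=> yS; have dyS : diff K q y \in S q.
  by apply: (subvP (sub_spP S q)); rewrite memv_img.
rewrite sclassE; apply/eqP; rewrite hclass_eq0 ?vsproj_cycles ?diff_cycles //.
apply/memv_imgP; exists (vsproj (S q.+1) y); rewrite ?memvf //.
by apply: val_inj; rewrite /= subvs_mapE ?sub_spP //= !vsprojK.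
Qed.

Lemma sclass_surj S q h :
  exists c, [/\ c \in S q, c \in cycles K q & sclass S q c = h].
Proof.
have [c cZ <-] := hclass_surj h; exists (vsval c); rewrite sclassE vsvalK subvsP.
split=> //; case: q h c cZ => [|q] h c; first by rewrite !memvf.
by rewrite !memv_ker => /eqP/(congr1 vsval); rewrite /= subvs_mapE ?sub_spP // => ->.
Qed.

Lemma homology_map_sclass S T q c : (forall p, (S p <= T p)%VS) ->
    c \in S q -> c \in cycles K q ->
  homology_map (sub_incl S T) q (sclass S q c) = sclass T q c.
Proof.
move=> ST cS cZ; rewrite !sclassE homology_map_hclass ?vsproj_cycles //.
  congr (hclass _ _ _); apply: val_inj.
  by rewrite /= sub_inclE //= !vsprojK // (subvP (ST q)).
exact: sub_incl_chain_map.
Qed.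

Definition rclass S T q : 'Hom(K q, homology (quot_complex (sub_in S T)) q) :=
  (hclass (quot_complex (sub_in S T)) q \o quotv_pi (sub_in S T q)
     \o linfun (vsproj (S q)))%VF.

Lemma rclassE S T q c : rclass S T q c =
  hclass (quot_complex (sub_in S T)) q (quotv_pi (sub_in S T q) (vsproj (S q) c)).
Proof.
have <- : linfun (vsproj (S q)) c = vsproj (S q) c by exact: lfunE.
by rewrite /rclass comp_lfunE comp_lfunE.
Qed.

Lemma rclass_eq0 S T q c : c \in S q -> c \in cycles K q -> rclass S T q c = 0 ->
  exists2 y, y \in S q.+1 & c - diff K q y \in T q.
Proof.
move=> cS cZ; rewrite rclassE => /eqP; rewrite hclass_eq0; last first.
  case: q c cS cZ => [|q] c cS; first by rewrite !memvf.
  rewrite /= !memv_ker => /eqP dc; rewrite (quotv_mapE _ (sub_spP (sub_in S T) _)).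
  rewrite -[X in quotv_pi _ X]vsvalK /= subvs_mapE ?sub_spP //= vsprojK // dc.
  by rewrite !linear0.
case/memv_imgP => h _; have : h \in limg (quotv_pi (sub_in S T q.+1)).
  by rewrite quotv_pi_surj memvf.
case/memv_imgP => y _ ->; rewrite /= (quotv_mapE _ (sub_spP (sub_in S T) _)) => /eqP.
rewrite -subr_eq0 -linearB -memv_ker quotv_pi_ker -memv_preim linfun_vsvalE /=.
rewrite vsprojK // subvs_mapE ?sub_spP // => cT.
by exists (vsval y); first exact: subvsP.
Qed.

End SubcomplexClasses.

(** * Components of a double chain at a single index set *)

Section Components.

Variables (F : fieldType) (X : cell_complex F) (n : nat).
Notation I := ({set 'I_n} * X)%type.
Notation M := {ffun {set 'I_n} * X -> F^o}.

Lemma chain_inP (A : {set X}) q (c : chain X q) :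
  reflect (forall s, c s != 0 -> val s \in A) (c \in chain_in A q).
Proof.
apply: (iffP idP) => [/memv_sumP[g gS ->] s | cA].
  apply: contraR => sA; rewrite sum_ffunE big1 // => t tA.
  have /vlineP[a ->] := gS t tA; rewrite !ffunE.
  by case: eqVneq tA => [<-|_]; rewrite ?(negPf sA) ?scaler0.
have -> : c = \sum_s c s *: cell_basis s.
  apply/ffunP => s; rewrite sum_ffunE (bigD1 s) //= big1 ?addr0 => [|t ts].
    by rewrite !ffunE eqxx [RHS]mulr1.
  by rewrite !ffunE eq_sym (negPf ts) scaler0.
apply: memv_suml => s _; have [->|/cA sA] := eqVneq (c s) 0.
  by rewrite scale0r mem0v.
by apply/memvZ/(subvP (sumv_sup s sA (subvv _)))/memv_line.
Qed.

Definition slice_fun (t : {set 'I_n}) q (x : M) : chain X q := [ffun s => x (t, val s)].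

Fact slice_linear t q : linear (@slice_fun t q).
Proof. by move=> a x y; apply/ffunP => s; rewrite !ffunE. Qed.
HB.instance Definition _ t q :=
  GRing.isLinear.Build F M (chain X q) _ (@slice_fun t q) (@slice_linear t q).
Definition slice t q : 'Hom(M, chain X q) := linfun (@slice_fun t q).

Lemma sliceE t q (x : M) s : slice t q x s = x (t, val s).
Proof. by rewrite lfunE ffunE. Qed.

Lemma slice_cbd t q (x : M) : slice t q (cbd x) = bd X q (slice t q.+1 x).
Proof.
apply/ffunP => s; rewrite sliceE cbdE lfunE ffunE /=.
rewrite (bigID (fun r : X => cdim r == q.+1)) /= addrC big1 ?add0r => [|r rq].
  rewrite (reindex_omap val (insub : X -> option (cell X q.+1))) /=; last first.
    by move=> r rq; rewrite insubT.
  apply: eq_big => r; first by rewrite (valP r) valK eqxx.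
  by rewrite sliceE.
have [->|/kappa_dim] := eqVneq (kappa r (val s)) 0; first by rewrite mulr0.
by rewrite (eqP (valP s)) => /eqP; rewrite (negPf rq).
Qed.

Definition glue (q : nat) (g : {set 'I_n} -> chain X q) : M :=
  [ffun i : I => oapp (g i.1) (0 : F^o) (insub i.2 : option (cell X q))].

Lemma slice_glue t q g : slice t q (glue g) = g t.
Proof. by apply/ffunP => s; rewrite sliceE ffunE /= valK. Qed.

End Components.

Arguments slice {F X n} t q.

(** A pair (s, j) with [j] in [s] and [s :\ j = t] is determined by [j], since [s = j |: t]. This
    turns the double sum of the Koszul differential into the sum in [kbd]. *)
Lemma sum_ksub_setU1 (V : nmodType) n p (t : ksub n p) (G : {set 'I_n} -> 'I_n -> V) :
  \sum_(s : ksub n p.+1) \sum_(j in val s | val t == val s :\ j) G (val s) j =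
  \sum_(j | j \notin val t) G (j |: val t) j.
Proof.
under eq_bigr do rewrite big_mkcond.
rewrite exchange_big [RHS]big_mkcond; apply: eq_bigr => j _ /=.
case: ifPn => jt; last first.
  rewrite big1 // => s _; case: ifP => // /andP[js /eqP tE].
  by rewrite tE !inE eqxx in jt.
have sP : #|j |: val t| == p.+1 by rewrite cardsU1 jt (eqP (valP t)).
rewrite (bigD1 (Sub (j |: val t) sP)) //= setU1K // setU11 eqxx big1 ?addr0 // => s.
apply: contraNeq; case: ifP => [/andP[js /eqP tE] _|]; last by rewrite eqxx.
by apply/eqP/val_inj; rewrite /= tE setD1K.
Qed.

(** * Vertical homology as the Koszul complex *)

Section Link.

Variables (F : fieldType) (X : cell_complex F) (n : nat).
Variables (Xf : filtration X n) (u : 'rV[int]_n).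

Notation M := {ffun {set 'I_n} * X -> F^o}.
Notation Xs s := (Xf (u - set_grade s)).
Notation V q := (pers_homology Xf q).
Notation bideg := (bideg Xf u).

Lemma slice_chain_in t p q x : x \in bideg p q -> slice t q x \in subcx (Xs t) q.
Proof.
by move/suppP => xS; apply/chain_inP => s; rewrite sliceE => /xS /and3P[].
Qed.

Lemma slice_cycles t q (x : M) : cbd x = 0 -> slice t q x \in cycles (chain_cx X) q.
Proof.
by case: q => [|q] dx; rewrite ?memvf //= memv_ker -slice_cbd dx linear0.
Qed.

Lemma slice_inj p q x y : x \in bideg p q -> y \in bideg p q ->
  (forall t : ksub n p, slice (val t) q x = slice (val t) q y) -> x = y.
Proof.
move=> xS yS xy; apply/eqP; rewrite -subr_eq0; set z := x - y.
have /suppP zS : z \in bideg p q by rewrite memvB.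
apply/eqP/ffunP => -[t s]; rewrite [RHS]ffunE; apply/eqP; apply: contraT => zts.
have /and3P[/= tp sq _] := zS _ zts.
have := congr1 (fun c : {ffun cell X q -> F^o} => c (Sub s sq)) (xy (Sub t tp)).
move/eqP; rewrite -subr_eq0 !sliceE /=.
by rewrite /z !ffunE in zts; rewrite (negPf zts).
Qed.

Lemma glue_bideg p q (g : ksub n p -> chain X q) :
    (forall t, g t \in subcx (Xs (val t)) q) ->
  exists2 x, x \in bideg p q & forall t, slice (val t) q x = g t.
Proof.
(* [h] extends [g] by zero to the index sets whose cardinality is not [p]. *)
move=> gS; pose h (t : {set 'I_n}) := oapp g 0 (insub t).
exists (glue h); last by move=> t; rewrite slice_glue /h valK.
apply/suppP => -[t s]; rewrite ffunE /= /h.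
case: (@insubP _ _ (cell X q) s) => [s' sq <-|] /=; last by rewrite eqxx.
case: (@insubP _ _ (ksub n p) t) => [t' tp <-|] /=; last by rewrite ffunE eqxx.
by move=> gs; rewrite (valP s') (valP t') /=; apply: (chain_inP _ _ (gS t')).
Qed.

(** On vertical cycles of [bideg p q] this is the passage to E^1: by [cls_surj], [cls_eq0] and
    [cls_cbd] it is onto the Koszul term, with the vertical boundaries as kernel. *)
Definition cls_fun p q (x : M) : koszul_sp (V q) u p :=
  dsum_mk (fun t : ksub n p => sclass (subcx (Xs (val t))) q (slice (val t) q x)).

Fact cls_linear p q : linear (@cls_fun p q).
Proof.
by move=> a x y; apply: dsumP => t; rewrite dsumDE dsumZE !dsum_mkE !linearP.
Qed.
HB.instance Definition _ p q := GRing.isLinear.Build F M (koszul_sp (V q) u p) _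
  (@cls_fun p q) (@cls_linear p q).
Definition cls p q : 'Hom(M, koszul_sp (V q) u p) := linfun (@cls_fun p q).

Lemma clsE p q x t : dsum_val (cls p q x) t =
  sclass (subcx (Xs (val t))) q (slice (val t) q x).
Proof. by rewrite lfunE dsum_mkE. Qed.

Lemma cls_surj p q k : exists w, [/\ w \in bideg p q, cbd w = 0 & cls p q w = k].
Proof.
have [g gP] := fin_all_exists (fun t : ksub n p => sclass_surj (dsum_val k t)).
have [|w wS wg] := glue_bideg (g := g); first by move=> t; case: (gP t).
exists w; split=> //; last first.
  by apply: dsumP => t; rewrite clsE wg; case: (gP t).
case: q k g gP wS wg => [|q] k g gP wS wg; first exact: cbd_bideg0 wS.
apply: (slice_inj (cbd_bideg wS)); rewrite ?mem0v // => t.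
rewrite slice_cbd wg linear0; have [_] := gP t.
by rewrite /= memv_ker => /eqP.
Qed.

Lemma cls_eq0 p q w : w \in bideg p q -> cbd w = 0 -> cls p q w = 0 ->
  exists2 y, y \in bideg p q.+1 & cbd y = w.
Proof.
move=> wS dw w0.
have wt (t : ksub n p) : exists y,
    y \in subcx (Xs (val t)) q.+1 /\ bd X q y = slice (val t) q w.
  have [|||y yS <-] := @sclass_eq0 _ _ (subcx (Xs (val t))) q (slice (val t) q w).
  - exact: slice_chain_in wS.
  - exact: slice_cycles.
  - by rewrite -clsE w0 dsum0E.
  by exists y.
have [g gP] := fin_all_exists wt.
have [|y yS yg] := glue_bideg (g := g); first by move=> t; case: (gP t).
exists y => //; apply: (slice_inj (cbd_bideg yS) wS) => t.
by rewrite slice_cbd yg; case: (gP t).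
Qed.

Lemma cls_cbd p q y : y \in bideg p q.+1 -> cls p q (cbd y) = 0.
Proof.
move=> yS; apply: dsumP => t; rewrite clsE dsum0E slice_cbd.
exact: (@sclass_diff _ (chain_cx X) _ q _ (slice_chain_in _ yS)).
Qed.

Lemma slice_kbd t q (x : M) : slice t q (kbd x) =
  \sum_(j | j \notin t) koszul_sign F (j |: t) j *: slice (j |: t) q x.
Proof.
apply/ffunP => s; rewrite sliceE kbdE sum_ffunE.
by apply: eq_bigr => j jt; rewrite !ffunE sliceE.
Qed.

(** The maps of [V q] come from inclusions and fix chain representatives, so [kbd] induces the
    Koszul differential; this identifies d^1. *)
Lemma koszul_diff_cls p q w : w \in bideg p.+1 q -> cbd w = 0 ->
  koszul_diff (V q) u p (cls p.+1 q w) = cls p q (kbd w).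
Proof.
move=> wS dw; rewrite lfunE; apply: dsumP => t; rewrite dsum_mkE clsE slice_kbd.
rewrite (linear_sum (sclass (subcx (Xs (val t))) q)).
apply: etrans (sum_ksub_setU1 t (fun s j =>
  sclass (subcx (Xs (val t))) q (koszul_sign F s j *: slice s q w))).
apply: eq_bigr => s _; apply: eq_bigr => j /andP[js /eqP tE].
have sZ a c : sclass (subcx (Xs (val t))) q (a *: c) =
    a *: sclass (subcx (Xs (val t))) q c by exact: linearZ.
rewrite sZ clsE; congr (_ *: _).
apply: homology_map_sclass (slice_chain_in _ wS) (slice_cycles _ _ dw) => r.
by apply/chain_inS/fil_mono/grade_le_subset; rewrite tE subD1set.
Qed.

End Link.

(** * Dimension estimates *)

Section Inequalities.

Variables (F : fieldType) (X : cell_complex F) (n : nat).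
Variables (Xf : filtration X n) (u : 'rV[int]_n) (q : nat).

Notation I := ({set 'I_n} * X)%type.
Notation M := {ffun {set 'I_n} * X -> F^o}.
Notation V q := (pers_homology Xf q).
Notation bideg := (bideg Xf u).
Notation totfil := (totfil Xf u).
Notation cls := (cls Xf u).

Definition col0 : {vspace M} := supp F [pred i : I | #|i.1| == 0].

(** In spectral-sequence terms, [killed r] collects the elements of D_(0,q) that are hit by d^0,
    ..., d^r. *)
Definition relcyc r : {vspace M} := (totfil r q.+1 :&: tot @^-1: col0)%VS.
Definition killed r : {vspace M} := (tot @: relcyc r)%VS.
Definition cyc0 : {vspace M} := (bideg 0 q :&: lker cbd)%VS.

Lemma proj_col0 p x : x \in col0 -> proj p.+1 x = 0.
Proof.
move/suppP => xS; apply/ffunP => i; rewrite restrictE ffunE /=.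
case: eqP => // ip; apply/eqP; apply: contraT => /xS /=.
by rewrite ip.
Qed.

Lemma proj0_col0 x : x \in col0 -> proj 0 x = x.
Proof.
move/suppP => xS; apply/ffunP => i; rewrite restrictE /=; case: ifPn => // ip.
by apply/esym/eqP; apply: contraNT ip => /xS.
Qed.

(* The leading term of [x] represents a class of [E^2_(r+2,q')].  If it vanishes,
   then a boundary [tot (y + eps w)] removes this term from [x]. *)
Lemma killed_step r q' : (r.+2 + q' = q.+1)%N ->
  (\dim (killed r.+2) <= \dim (killed r.+1) + xi Xf q' r.+2 u)%N.
Proof.
move=> rq.
apply: (dim_limg_le
  (g := (hclass (koszul (V q') u) r.+2 \o cls r.+2 q' \o proj r.+2)%VF)).
move=> x; rewrite memv_cap -memv_preim => /andP[xT tx].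
set x2 := proj r.+2 x; set x1 := proj r.+1 x.
have x2D : x2 \in bideg r.+2 q' by apply: (@proj_bideg _ _ _ _ _ r.+2); rewrite rq.
have x1D : x1 \in bideg r.+1 q'.+1.
  by apply: (@proj_bideg _ _ _ _ _ r.+2); rewrite addnS -addSn rq.
(* Nothing of [x] lies beyond column [r.+2], so [cbd x2] is the whole component of [tot x] there,
   and [tot x] lives in column 0. *)
have dx2 : cbd x2 = 0.
  have := proj_col0 r.+1 tx; rewrite proj_tot (proj_totfil_gt (ltnSn _) xT).
  by rewrite !linear0 addr0.
(* Column [r.+1] is not column 0 either, so [tot x] vanishes there too; this makes the class of [x2]
   a Koszul cycle. *)
have kx2 : kbd x2 = cbd (eps x1).
  have := proj_col0 r tx; rewrite proj_tot -/x1 -/x2 => /(congr1 eps).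
  by rewrite linearD linear0 /= epsK eps_cbd => /eqP; rewrite addrC subr_eq0 => /eqP.
rewrite comp_lfunE comp_lfunE -/x2 => /eqP; rewrite hclass_eq0; last first.
  by rewrite /= memv_ker koszul_diff_cls // kx2 cls_cbd // eps_bideg.
case/memv_imgP => k _; have [w [wD dw <-]] := cls_surj k.
rewrite /= koszul_diff_cls // => clsE.
have [||| y yD yE] := @cls_eq0 _ _ _ Xf u r.+2 q' (x2 - kbd w).
- by rewrite memvB ?kbd_bideg.
- by rewrite linearB /= cbd_kbd dw dx2 linear0 subrr.
- by rewrite linearB /= clsE subrr.
(* The terms in [kbd w] cancel, and what remains besides [x2] lies in column [r.+1]. *)
have tz : tot (y + eps w) = x2 + eps (kbd y).
  rewrite linearD /= !totE yE -(opprK (cbd (eps w))) -eps_cbd dw.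
  by rewrite linear0 oppr0 add0r [eps (kbd (eps w))]eps_kbd epsK addrAC subrK.
have -> : tot x = tot (x - tot (y + eps w)) by rewrite linearB /= tot_tot subr0.
apply: memv_img; rewrite memv_cap -memv_preim linearB /= tot_tot subr0 tx andbT.
rewrite tz opprD addrA memvB ?totfil_subproj //.
by rewrite -rq addSnnS (bideg_totfil (leqnn _)) // eps_bideg // kbd_bideg.
Qed.

(** Rank and nullity for the map from [cyc0] onto the Koszul homology in degree 0. Its kernel
    contains [killed 1]: there [tot x] is a vertical boundary plus [kbd] of a vertical cycle, whose
    class is a Koszul boundary. *)
Lemma betti0_killed : (\dim (killed 1) + xi Xf q 0 u <= \dim cyc0)%N.
Proof.
pose g := (hclass (koszul (V q) u) 0 \o cls 0 q)%VF.
rewrite -(limg_ker_dim g cyc0); apply: leq_add; apply: dimvS.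
  apply/subvP => _ /memv_imgP[x + ->].
  rewrite memv_cap -memv_preim => /andP[xT tx].
  have x0D : proj 0 x \in bideg 0 q.+1 by apply: (@proj_bideg _ _ _ _ _ 1).
  have x1D : proj 1 x \in bideg 1 q by apply: (@proj_bideg _ _ _ _ _ 1).
  have dx1 : cbd (proj 1 x) = 0.
    have := proj_col0 0 tx; rewrite proj_tot (proj_totfil_gt (ltnSn _) xT).
    by rewrite !linear0 addr0.
  have dex1 : cbd (eps (proj 1 x)) = 0.
    by apply: oppr_inj; rewrite -eps_cbd dx1 !linear0.
  rewrite -(proj0_col0 tx) proj_tot eps_kbd memv_cap [_ \in cyc0]memv_cap.
  apply/andP; split.
    rewrite memvD ?cbd_bideg ?kbd_bideg ?eps_bideg //= memv_ker.
    by rewrite linearD /= cbd_cbd cbd_kbd dex1 linear0 addr0.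
  rewrite memv_ker comp_lfunE linearD /= cls_cbd // add0r -koszul_diff_cls ?eps_bideg //.
  by rewrite hclass_eq0 ?memvf // memv_img ?memvf.
apply/subvP => h _; have [k _ <-] := hclass_surj h.
have [w [wD dw <-]] := cls_surj k.
by rewrite -[hclass _ _ _]comp_lfunE memv_img // memv_cap wD memv_ker dw /=.
Qed.

Lemma subr_set_grade0 : u - set_grade set0 = u.
Proof. by rewrite /set_grade big_set0 subr0. Qed.

(** A cycle with zero relative class is [cbd y'] plus a chain supported on [A], and [tot_zigzag]
    makes the latter a total boundary. Total degree [q.+1] meets only columns up to [q.+1], hence
    the index of [killed]. *)
Lemma cyc0_killed : (\dim cyc0 <= \dim (killed q.+1) + mu Xf q u)%N.
Proof.
pose A := bigcup_subcomplex (fun j : 'I_n => Xf (u - unit_grade j)).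
rewrite -[cyc0]lim1g.
apply: (dim_limg_le (g := (rclass (subcx (Xf u)) (subcx A) q \o slice set0 q)%VF)).
move=> z; rewrite id_lfunE memv_cap => /andP[zD]; rewrite memv_ker => /eqP dz.
have xu s : (s \in Xf (u - set_grade set0)) = (s \in Xf u) by rewrite subr_set_grade0.
rewrite comp_lfunE => /rclass_eq0 [||y yS yA].
- apply/chain_inP => s; rewrite sliceE.
  by move/(suppP _ _ zD)/and3P => [_ _]; rewrite xu.
- exact: slice_cycles.
(* The bounding chain [y] is placed in column 0, whose only index set is empty. *)
have [|y' y'D y'E] := glue_bideg (Xf := Xf) (u := u) (p := 0) (g := fun=> y).
  move=> t; have -> : val t = set0 by apply/eqP; rewrite -cards_eq0 (valP t).
  by rewrite subr_set_grade0.
pose c0 : ksub n 0 := Sub set0 (introT eqP (cards0 _)).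
have {}y'E : slice set0 q.+1 y' = y := y'E c0.
have aD : z - cbd y' \in bideg 0 q by rewrite memvB // cbd_bideg.
have [|||x xT xE] := tot_zigzag aD.
- exact: kbd_bideg0 aD.
- by rewrite linearB /= cbd_cbd dz subrr.
- move=> [t s] zs; have /and3P[/= t0 sq _] := suppP _ _ aD _ zs.
  have {}t0 : t = set0 by apply/eqP; rewrite -cards_eq0.
  rewrite t0 in zs.
  have := chain_inP _ _ yA (Sub s sq); rewrite -y'E; apply.
  by rewrite -slice_cbd -linearB sliceE.
have -> : z = tot (x + y').
  by rewrite linearD /= xE totE (kbd_bideg0 y'D) linear0 addr0 subrK.
apply: memv_img; rewrite memv_cap; apply/andP; split.
  by rewrite memvD //; exact: (bideg_totfil (leq0n q.+1) y'D).
rewrite -memv_preim linearD /= xE totE (kbd_bideg0 y'D) linear0 addr0 subrK.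
by apply/suppP => i /(suppP _ _ zD)/and3P[].
Qed.

End Inequalities.

(** * Telescoping the estimates *)

Theorem corollary5p2 (F : fieldType) (n : nat) (n_gt0 : (0 < n)%N)
    (X : cell_complex F) (Xf : filtration X n) (q : nat) (u : 'rV[int]_n) :
  (xi Xf q 0 u)%:Z - \sum_(1 <= p < q.+2) (xi Xf (q.+1 - p) p u)%:Z
    <= (mu Xf q u)%:Z.
Proof.
have W r : (r <= q)%N -> (\dim (killed Xf u q r.+1) <= \dim (killed Xf u q 1) +
    \sum_(2 <= p < r.+2) xi Xf (q.+1 - p) p u)%N.
  elim: r => [|r IHr] rq; first by rewrite big_geq ?addn0.
  rewrite big_nat_recr //= addnA.
  apply: leq_trans (killed_step (q' := q.+1 - r.+2) _ _ _) _; first by rewrite subnKC.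
  by rewrite leq_add2r IHr // ltnW.
(* With the sum moved to the right this is an inequality in [nat]; the term [p = 1] is split off so
   that the rest matches the sum in [W]. *)
rewrite lerBlDr -(big_morph Posz PoszD (erefl _)) -PoszD lez_nat big_ltn //.
have := leq_trans (betti0_killed Xf u q) (cyc0_killed Xf u q).
move/leq_trans => /(_ _ (leq_add (W q (leqnn _)) (leqnn _))).
(* The dimension of [killed 1] occurs on both sides and cancels. *)
rewrite -addnA leq_add2l => /leq_trans; apply.
by rewrite addnC leq_add2l leq_addl.
Qed.
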